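(* For odd $n$, let $\mathrm{MAJ}_n:\{0,1\}^n\to\{0,1\}$ be defined by $\mathrm{MAJ}_n(x_1,\dots,x_n)=1$ if $\sum_{i=1}^n x_i\ge (n+1)/2$ and $0$ otherwise. With $p_n\equiv1/2$ and only considering odd $n$, the sequence $\{\mathrm{MAJ}_n\}_{n\ge1}$ is noise stable but not tame (with respect to $\{p_n\}$).
   Context: For Boolean functions $f_n:\{0,1\}^{m_n}\to\{0,1\}$ and $p_n\in[0,1]$, let $X^{(n)}(t)=(X^{(n)}_1(t),\dots,X^{(n)}_{m_n}(t))$, $t\ge0$, where the coordinates are independent stationary continuous-time Markov chains on $\{0,1\}$ jumping from $0$ to $1$ at rate $p_n$ and from $1$ to $0$ at rate $1-p_n$ (so each is $1$ with probability $p_n$ at any fixed time). $C_n$ is the number of times $f_n(X^{(n)}(t))$ changes state during $[0,1]$. The sequence is tame with respect to $\{p_n\}$ if $\{C_n\}$ is tight. Noise stability: let $\omega_n\in\{0,1\}^{m_n}$ have i.i.d. coordinates equal to $1$ with probability $p_n$ and $0$ with probability $1-p_n$, and let $\omega_n^{\epsilon}$ be obtained from $\omega_n$ by independently for each bit, with probability $\epsilon$, replacing it by a fresh bit equal to $1$ with probability $p_n$ and $0$ with probability $1-p_n$, independently of everything else. The sequence is noise stable with respect to $\{p_n\}$ if for every $\delta>0$ there is $\epsilon>0$ with $\sup_n\mathbb{P}(f_n(\omega_n)\ne f_n(\omega_n^{\epsilon}))\le\delta$. *)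

(* Defs.v *)
From HB Require Import structures.
From mathcomp Require Import all_boot all_order all_algebra.
From mathcomp Require Import all_classical all_reals all_analysis.
Set Implicit Arguments.
Unset Strict Implicit.
Unset Printing Implicit Defensive.
Import Order.TTheory GRing.Theory Num.Theory.
Import numFieldNormedType.Exports.
Local Open Scope classical_set_scope.
Local Open Scope ring_scope.

Definition boolean_function (m : nat) : Type := {ffun 'I_m -> bool} -> bool.

(* On odd n, which is the only case used, n.+1./2 is exactly (n + 1) / 2. *)
Definition MAJ (n : nat) : boolean_function n :=
  fun x => (n.+1./2 <= \sum_(i < n) x i)%N.

Arguments MAJ : clear implicits.

Section noise_stability.
Context {R : realType}.

Definition product_pmf (m : nat) (p : R) (x : {ffun 'I_m -> bool}) : R :=
  \prod_(i < m) bernoulli_pmf p (x i).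

Definition rerandomize (m : nat) (x r y : {ffun 'I_m -> bool}) :
    {ffun 'I_m -> bool} :=
  [ffun i => if r i then y i else x i].

(* P(f(w) <> f(w^e)), on the finite product space carrying the independent
   triple of w, the set r of the bits that are replaced (each with probability
   e), and the fresh bits y. *)
Definition disagreement_probability (m : nat) (f : boolean_function m)
    (p e : R) : R :=
  \sum_(x : {ffun 'I_m -> bool}) \sum_(r : {ffun 'I_m -> bool})
    \sum_(y : {ffun 'I_m -> bool} | f x != f (rerandomize x r y))
      product_pmf p x * product_pmf e r * product_pmf p y.

Definition noise_stable (m : nat -> nat)
    (f : forall n, boolean_function (m n)) (p : nat -> R) : Prop :=
  forall delta : R, 0 < delta -> exists2 e : R, 0 < e <= 1 &
    (ereal_sup [set (disagreement_probability (f n) (p n) e)%:E | n in setT]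
      <= delta%:E)%E.

End noise_stability.

(* Processes are functions of all real times, but only the times t >= 0
   matter. *)
Section dynamics.
Context {R : realType} {d : measure_display} {T : measurableType d}.
Variable P : probability T R.

Definition cadlag (g : R -> bool) : Prop :=
  (forall t, 0 <= t -> g s @[s --> t^'+] --> g t) /\
  (forall t, 0 < t -> cvg (g s @[s --> t^'-])).

(* The Q-matrix of the chain on {0,1} that jumps from a to ~~ a at rate
   rate a. *)
Definition generator (rate : bool -> R) (a b : bool) : R :=
  if a == b then - rate a else rate a.

(* Kolmogorov's forward equation: pt t is the matrix exponential of t Q. *)
Definition transition_function (Q : bool -> bool -> R)
    (pt : R -> bool -> bool -> R) : Prop :=
  (forall a b, pt 0 a b = (a == b)%:R) /\
  (forall t a b, is_derive t (1 : R) (fun s => pt s a b)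
                   (\sum_(c : bool) pt t a c * Q c b)).

Definition markov_chain (rate : bool -> R) (Y : R -> T -> bool) : Prop :=
  [/\ forall t, 0 <= t -> measurable_fun setT (Y t),
      forall w, cadlag (fun t => Y t w) &
      exists2 pt, transition_function (generator rate) pt &
        forall (k : nat) (t : nat -> R) (a : nat -> bool),
          0 <= t 0%N -> (forall j, (j < k)%N -> t j <= t j.+1) ->
          P [set w | forall j, (j <= k)%N -> Y (t j) w = a j] =
          (P [set w | Y (t 0%N) w = a 0%N] *
           (\prod_(j < k) pt (t j.+1 - t j) (a j) (a j.+1))%:E)%E].

Definition stationary (Y : R -> T -> bool) : Prop :=
  forall (s : R) (k : nat) (t : nat -> R) (a : nat -> bool),
    0 <= s -> (forall j, (j <= k)%N -> 0 <= t j) ->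
    P [set w | forall j, (j <= k)%N -> Y (t j + s) w = a j] =
    P [set w | forall j, (j <= k)%N -> Y (t j) w = a j].

Definition process_sigma_algebra (Y : R -> T -> bool) : set (set T) :=
  <<s [set A | exists2 t : R, 0 <= t & exists B : set bool, A = Y t @^-1` B] >>.

(* Taking some of the A i to be setT yields the product rule over every
   subfamily. *)
Definition independent_processes (m : nat) (X : 'I_m -> R -> T -> bool) :
    Prop :=
  forall A : 'I_m -> set T, (forall i, process_sigma_algebra (X i) (A i)) ->
    P (\bigcap_(i in [set: 'I_m]) A i) = (\prod_(i < m) fine (P (A i)))%:E.

Definition dynamics (m : nat) (p : R) (X : 'I_m -> R -> T -> bool) : Prop :=
  (forall i, markov_chain (fun a => if a then 1 - p else p) (X i) /\
             stationary (X i)) /\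
  independent_processes X.

End dynamics.

Section tameness.
Context {R : realType}.

(* A change of state at time t is a jump, i.e., g(t-) <> g(t); the number of
   them is +oo if they are infinitely many. *)
Definition number_of_changes (g : R -> bool) : \bar R :=
  counting [set t : R | 0 < t <= 1 /\ ~ (g s @[s --> t^'-] --> g t)].

Definition changes (T : Type) (m : nat) (f : boolean_function m)
    (X : 'I_m -> R -> T -> bool) (w : T) : \bar R :=
  number_of_changes (fun t => f [ffun i => X i t w]).

Definition tight (d : nat -> measure_display)
    (T : forall n, measurableType (d n)) (P : forall n, probability (T n) R)
    (C : forall n, T n -> \bar R) : Prop :=
  forall e : R, 0 < e -> exists M : R, forall n,
    (P n [set w | M%:E < C n w] <= e%:E)%E.

(* X n is a realization of the dynamics of the bits of f n, on its own
   probability space; tameness depends on it only through its law. *)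
Definition tame (m : nat -> nat) (f : forall n, boolean_function (m n))
    (d : nat -> measure_display) (T : forall n, measurableType (d n))
    (P : forall n, probability (T n) R)
    (X : forall n, 'I_(m n) -> R -> T n -> bool) : Prop :=
  tight P (fun n => changes (f n) (X n)).

End tameness.

(* Main.v *)
Require Import Defs.
From mathcomp Require Import all_boot all_order all_algebra.
From mathcomp Require Import all_classical all_reals all_analysis.
From mathcomp Require Import measurable_realfun ring lra zify.
Set Implicit Arguments.
Unset Strict Implicit.
Unset Printing Implicit Defensive.
Import Order.TTheory GRing.Theory Num.Theory.
Import numFieldNormedType.Exports.
Local Open Scope classical_set_scope.
Local Open Scope ring_scope.

(* A bit observed at two times t apart behaves as if it were resampled with
   probability q = 1 - exp (-t), so both halves of the theorem are governed by
   one kernel on the cube.  Write n = 2k + 1 and weight x for the number of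
   ones of x.

   Stability: if the majority of x and y differ then either the weight of x is
   within J of n / 2, which has probability O(J / sqrt n), or the weights of x
   and y differ by more than J, which has probability O(n q / J^2) by
   Chebyshev; take J of order sqrt n.

   Non-tameness is a second moment argument.  On the grid of times j / n let V
   count the j such that the weight is k + 1 at time j / n and at most k at the
   next time.  Then E V is at least of order sqrt n.  Conditionally on the set
   of resampled bits the weight is a shifted binomial variable, so the
   probability of a given weight a time t later is at most about
   1 / sqrt (n t), and summing over pairs of times gives E V^2 = O(n).  Hence V
   is of order sqrt n with probability bounded below, and V is at most the
   number of changes of the majority. *)

(** * Binomial coefficients *)

Lemma bin_leS n k : (k.*2 < n)%N -> ('C(n, k) <= 'C(n, k.+1))%N.
Proof.
move=> kn; have := mul_bin_left n k.
have : (k.+1 <= n - k)%N by lia.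
move: (n - k)%N => j kj e.
by rewrite -(leq_pmul2l (ltn0Sn k)) e leq_mul2r kj orbT.
Qed.

Lemma bin_le_half n k : ('C(n, k) <= 'C(n, n./2))%N.
Proof.
wlog kn : k / (k <= n./2)%N.
  move=> H; have [/H//|kn] := leqP k n./2.
  have [nk|nk] := ltnP n k; first by rewrite bin_small.
  by rewrite -bin_sub//; apply: H; lia.
have [j] := ubnPeq (n./2 - k)%N; elim: j => [|j IH] in k kn *.
  by move=> e; have -> : k = n./2 by lia.
move=> e; apply: (leq_trans (bin_leS _)); first lia.
by apply: IH; lia.
Qed.

Lemma bin_odd_middle m : 'C(m.*2.+1, m) = 'C(m.*2.+1, m.+1).
Proof. by rewrite -bin_sub; [congr 'C(_, _); lia | lia]. Qed.

Lemma double_bin_odd m : (2 * 'C(m.*2.+1, m.+1) = 'C(m.+1.*2, m.+1))%N.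
Proof. by rewrite doubleS [in RHS]binS bin_odd_middle mul2n addnn. Qed.

Lemma central_binS m :
  (m.+1 * 'C(m.+1.*2, m.+1) = 2 * (m.*2.+1 * 'C(m.*2, m)))%N.
Proof.
by have := mul_bin_diag m.*2.+1 m; rewrite /= -double_bin_odd; lia.
Qed.

(** Induction with [central_binS]; the step reduces to [(2m+1)(2m+3) <= (2m+2)^2]. *)
Lemma central_bin_le m : ('C(m.*2, m) ^ 2 * m.*2.+1 <= 16 ^ m)%N.
Proof.
elim: m => [|m IH] //; have e := central_binS m.
rewrite -(leq_pmul2l (_ : 0 < m.+1 ^ 2)%N)// (expnS 16).
have -> : (m.+1 ^ 2 * ('C(m.+1.*2, m.+1) ^ 2 * m.+1.*2.+1) =
   'C(m.*2, m) ^ 2 * m.*2.+1 * (4 * m.*2.+1 * m.*2.+3))%N.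
  have -> : (m.+1 ^ 2 * ('C(m.+1.*2, m.+1) ^ 2 * m.+1.*2.+1) =
     (m.+1 * 'C(m.+1.*2, m.+1)) ^ 2 * m.+1.*2.+1)%N by rewrite expnMn; lia.
  by rewrite e doubleS; lia.
have h : (4 * m.*2.+1 * m.*2.+3 <= 16 * m.+1 ^ 2)%N by lia.
by apply: leq_trans (leq_mul IH h) _; rewrite mulnCA mulnA mulnC mulnA.
Qed.

(** Here the induction step reduces to [4j(j+1) <= (2j+1)^2] with [j = m+1]. The index starts at 1,
    where equality holds; at 0 the right side would vanish. *)
Lemma central_bin_ge m : (16 ^ m.+1 <= 'C(m.+1.*2, m.+1) ^ 2 * (4 * m.+1))%N.
Proof.
elim: m => [|m IH] //; have e := central_binS m.+1.
rewrite -(leq_pmul2l (_ : 0 < m.+2 ^ 2)%N)//.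
have -> : (m.+2 ^ 2 * ('C(m.+2.*2, m.+2) ^ 2 * (4 * m.+2)) =
   (m.+2 * 'C(m.+2.*2, m.+2)) ^ 2 * (4 * m.+2))%N by rewrite expnMn; lia.
rewrite e (expnS 16).
apply: (@leq_trans (m.+2 ^ 2 * (16 * ('C(m.+1.*2, m.+1) ^ 2 * (4 * m.+1)))))%N.
  by rewrite !leq_mul2l IH !orbT.
move: ('C(_, _)) => c.
have -> : (m.+2 ^ 2 * (16 * (c ^ 2 * (4 * m.+1))) =
  c ^ 2 * (64 * m.+2 * (m.+2 * m.+1)))%N by lia.
have -> : ((2 * (m.+1.*2.+1 * c)) ^ 2 * (4 * m.+2) =
  c ^ 2 * (16 * m.+2 * m.+1.*2.+1 ^ 2))%N by rewrite !expnMn; lia.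
by rewrite leq_mul2l; apply/orP; right; nia.
Qed.

(** The middle coefficient is the largest of its row; in an odd row it is half the central
    coefficient of the next row, so [central_bin_le] covers both parities. *)
Lemma bin_sqr_le n k : ('C(n, k) ^ 2 * n.+1 <= 4 ^ n)%N.
Proof.
apply: (@leq_trans ('C(n, n./2) ^ 2 * n.+1)).
  by rewrite leq_mul2r leq_exp2r// bin_le_half orbT.
have h16 j : (16 ^ j = 4 ^ j.*2)%N by rewrite -mul2n expnM.
have [m [->|->]] : exists m, n = m.*2 \/ n = m.*2.+1.
  by exists n./2; lia.
  by rewrite doubleK -h16 central_bin_le.
have -> : (m.*2.+1)./2 = m by lia.
have := central_bin_le m.+1; rewrite -double_bin_odd -bin_odd_middle h16 doubleS.
by rewrite expnMn !(expnS 4); nia.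
Qed.

Section binomial_reals.
Context {R : realType}.

Lemma bin_prob_le n k : 'C(n, k)%:R / 2 ^+ n <= (Num.sqrt n.+1%:R)^-1 :> R.
Proof.
have s0 : 0 < Num.sqrt n.+1%:R :> R by rewrite sqrtr_gt0 ltr0n.
have p0 : 0 < 2 ^+ n :> R by rewrite exprn_gt0.
rewrite ler_pdivrMr// mulrC ler_pdivlMr//.
rewrite -(@ler_pXn2r _ 2) ?nnegrE ?mulr_ge0 ?(ltW s0) ?(ltW p0)//.
rewrite exprMn sqr_sqrtr// -exprM -!natrX -natrM ler_nat (mulnC n) expnM.
exact: bin_sqr_le.
Qed.

Lemma middle_bin_prob_ge k :
  (2 * Num.sqrt k.+1%:R)^-1 <= 'C(k.*2.+1, k.+1)%:R / 2 ^+ k.*2.+1 :> R.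
Proof.
have s0 : 0 < Num.sqrt k.+1%:R :> R by rewrite sqrtr_gt0 ltr0n.
have p0 : 0 < 2 ^+ k.*2.+1 :> R by rewrite exprn_gt0.
have h := central_bin_ge k; rewrite -double_bin_odd in h.
rewrite ler_pdivlMr// mulrC ler_pdivrMr ?mulr_gt0//.
rewrite -(@ler_pXn2r _ 2) ?nnegrE ?mulr_ge0 ?(ltW s0) ?(ltW p0)//.
rewrite !exprMn sqr_sqrtr// -exprM -!natrX -!natrM ler_nat.
move: h; rewrite (_ : 16 = 2 ^ 4)%N// -expnM.
have -> : (4 * k.+1 = (k.*2.+1 * 2).+2)%N by lia.
by rewrite expnMn !expnS; lia.
Qed.

End binomial_reals.

(** * Resampling on the cube *)

Definition weight (n : nat) (x : {ffun 'I_n -> bool}) : nat := (\sum_(i < n) x i)%N.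

Section cube.
Context {R : realType} {n : nat}.
Local Notation cube := {ffun 'I_n -> bool}.
Implicit Types (x y z r : cube) (q : R).

Lemma weight_le x : (weight x <= n)%N.
Proof.
rewrite /weight -[leqRHS]card_ord -sum1_card.
by apply: leq_sum => i _; case: (x i).
Qed.

(** Generating function in the weight: expanding the product picks one value per coordinate, and
    each 1 contributes a factor ['X]. *)
Lemma sum_weight_eq (F : 'I_n -> bool -> R) s :
  \sum_(x : cube) (weight x == s)%:R * \prod_i F i (x i) =
  (\prod_i ((F i false)%:P + F i true *: 'X))`_s.
Proof.
have -> : \prod_i ((F i false)%:P + F i true *: 'X) =
    \prod_i \sum_(b : bool) F i b *: 'X^b :> {poly R}.
  apply: eq_bigr => i _.
  by rewrite big_bool /= expr0 expr1 addrC alg_polyC.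
rewrite bigA_distr_bigA coef_sum; apply: eq_bigr => x _.
by rewrite scaler_prod prodrXr coefZ coefXn eq_sym mulrC.
Qed.

Lemma coef_1DXn w k : ((1 + 'X : {poly R}) ^+ w)`_k = 'C(w, k)%:R.
Proof.
elim: w k => [|w IH] k; first by rewrite expr0 coef1 bin0n.
rewrite exprSr mulrDr mulr1 coefD coefMX !IH; case: k => [|k] /=.
  by rewrite !bin0 addr0.
by rewrite binS natrD.
Qed.

Lemma sum_cube_weight_eq s : \sum_(x : cube) (weight x == s)%:R = 'C(n, s)%:R :> R.
Proof.
transitivity (\sum_(x : cube) (weight x == s)%:R * \prod_(i < n) (1 : R)).
  by apply: eq_bigr => x _; rewrite big1// mulr1.
rewrite (sum_weight_eq (fun _ _ => 1)).
by rewrite prodr_const card_ord scale1r coef_1DXn.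
Qed.

Lemma product_pmf_weight q r :
  product_pmf q r = q ^+ weight r * (1 - q) ^+ (n - weight r).
Proof.
have -> : (n - weight r = \sum_(i < n) ~~ r i)%N.
  rewrite -[X in (X - _)%N]card_ord -sum1_card -sumnB.
    by apply: eq_bigr => i _; case: (r i).
  by move=> i _; case: (r i).
rewrite -!prodrXr -big_split/=; apply: eq_bigr => i _.
by rewrite /bernoulli_pmf; case: (r i); rewrite !(expr0, expr1, mulr1, mul1r).
Qed.

Lemma sum_product_pmf_weight q (h : nat -> R) :
  \sum_(r : cube) product_pmf q r * h (weight r) =
  \sum_(k < n.+1) 'C(n, k)%:R * (q ^+ k * (1 - q) ^+ (n - k)) * h k.
Proof.
under [RHS]eq_bigr do rewrite -sum_cube_weight_eq mulrAC mulr_suml mulr_suml.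
rewrite exchange_big; apply: eq_bigr => r _ /=.
have wr : (weight r < n.+1)%N by rewrite ltnS weight_le.
rewrite (bigD1 (Ordinal wr))//= eqxx mul1r big1 => [|k kr].
  by rewrite addr0 mulrC product_pmf_weight.
by rewrite (_ : weight r == k = false) ?mul0r// eq_sym; apply: negbTE.
Qed.

Lemma product_pmf_ge0 q r : 0 <= q <= 1 -> 0 <= product_pmf q r.
Proof. by move=> q01; apply: prodr_ge0 => i _; apply: bernoulli_pmf_ge0. Qed.

Lemma sum_product_pmf q : \sum_(r : cube) product_pmf q r = 1.
Proof.
rewrite -(bigA_distr_bigA (fun _ => bernoulli_pmf q)) big1// => i _.
by rewrite big_bool /= addrC subrK.
Qed.

Lemma product_pmf_half x : product_pmf (2^-1 : R) x = (2 ^+ n)^-1.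
Proof.
rewrite /product_pmf -exprVn -[X in _ ^+ X]card_ord -prodr_const.
by apply: eq_bigr => i _; rewrite /bernoulli_pmf; case: (x i) => //; field.
Qed.

(** Since [C(n,k)/(k+1) = C(n+1,k+1)/(n+1)], the sum times [(n+1)q] is the binomial expansion of
    [(q + (1-q))^(n+1)] without its term of index 0. *)
Lemma inverse_moment q : 0 < q <= 1 ->
  \sum_(r : cube) product_pmf q r * (weight r).+1%:R^-1 <= (n.+1%:R * q)^-1.
Proof.
move=> /andP[q0 q1]; have nq0 : 0 < n.+1%:R * q by rewrite mulr_gt0.
rewrite (sum_product_pmf_weight q (fun k => k.+1%:R^-1)).
rewrite -[leRHS]mul1r ler_pdivlMr// mulr_suml.
have total : \sum_(k < n.+2) 'C(n.+1, k)%:R * (q ^+ k * (1 - q) ^+ (n.+1 - k)) = 1.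
  transitivity ((1 - q + q) ^+ n.+1); last by rewrite subrK expr1n.
  by rewrite exprDn; apply: eq_bigr => k _; rewrite -[RHS]mulr_natl [q ^+ _ * _]mulrC.
rewrite -[leRHS]total [leRHS]big_ord_recl /= -[leLHS]add0r lerD//.
  by rewrite !mulr_ge0 ?exprn_ge0 ?subr_ge0 ?(ltW q0).
apply: ler_sum => k _; rewrite /bump /= add1n subSS.
have e : k.+1%:R * 'C(n.+1, k.+1)%:R = n.+1%:R * 'C(n, k)%:R :> R.
  by rewrite -!natrM -mul_bin_diag.
have k0 : k.+1%:R != 0 :> R by [].
rewrite le_eqVlt; apply/orP; left; apply/eqP; apply: (mulfI k0); rewrite [RHS]mulrA e exprS.
by field.
Qed.

(* Jensen's inequality for 1/sqrt, obtained from AM-GM. *)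
Lemma inverse_sqrt_moment q : 0 < q <= 1 ->
  \sum_(r : cube) product_pmf q r * (Num.sqrt (weight r).+1%:R)^-1 <=
  (Num.sqrt (n.+1%:R * q))^-1.
Proof.
move=> /[dup] q01 /andP[q0 q1]; have nq0 : 0 < n.+1%:R * q by rewrite mulr_gt0.
set l := Num.sqrt (n.+1%:R * q).
have l0 : 0 < l by rewrite sqrtr_gt0.
(* AM-GM with the scale [l] for which [inverse_moment] bounds the mean of each of the two summands
   by [l^-1]. *)
have le w : (Num.sqrt w.+1%:R)^-1 <= 2^-1 * (l * w.+1%:R^-1 + l^-1) :> R.
  set s := Num.sqrt _; have s0 : 0 < s by rewrite sqrtr_gt0 ltr0n.
  have -> : w.+1%:R = s ^+ 2 :> R by rewrite sqr_sqrtr.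
  rewrite -subr_ge0.
  have -> : 2^-1 * (l / s ^+ 2 + l^-1) - s^-1 = 2^-1 * l * (s^-1 - l^-1) ^+ 2.
    by field; rewrite !gt_eqF.
  by apply: mulr_ge0; rewrite ?sqr_ge0 ?mulr_ge0 ?invr_ge0 ?(ltW l0).
apply: (@le_trans _ _ (\sum_(r : cube) product_pmf q r *
    (2^-1 * (l * (weight r).+1%:R^-1 + l^-1)))).
  by apply: ler_sum => r _; apply: ler_wpM2l => //; rewrite product_pmf_ge0// (ltW q0).
under eq_bigr do rewrite mulrCA mulrDr mulrCA.
rewrite -mulr_sumr big_split/= -mulr_sumr -mulr_suml sum_product_pmf mul1r.
have := inverse_moment q01.
rewrite -(sqr_sqrtr (ltW nq0)) -/l; set m := \sum_(r : cube) _ => hm.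
have : l * m <= l^-1.
  by apply: le_trans (ler_wpM2l (ltW l0) hm) _; rewrite invfM mulrA divff ?mul1r// gt_eqF.
by lra.
Qed.

Definition resample q (a b : bool) : R := (1 - q) * (a == b)%:R + q / 2.

Definition resample_kernel q x y : R := \prod_i resample q (x i) (y i).

Lemma resample_ge0 q a b : 0 <= q <= 1 -> 0 <= resample q a b.
Proof.
by move=> /andP[q0 q1]; rewrite addr_ge0 ?mulr_ge0 ?subr_ge0 ?ler0n ?invr_ge0.
Qed.

Lemma resample_kernel_ge0 q x y : 0 <= q <= 1 -> 0 <= resample_kernel q x y.
Proof. by move=> q01; apply: prodr_ge0 => i _; apply: resample_ge0. Qed.

Lemma sum_resample_kernel q x : \sum_(y : cube) resample_kernel q x y = 1.
Proof.
rewrite -(bigA_distr_bigA (fun i b => resample q (x i) b)) big1// => i _.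
by rewrite big_bool /resample; case: (x i) => /=; field.
Qed.

(* Conditionally on the set r of resampled bits, the weight is a constant plus
   a binomial variable of parameters (weight r, 1/2). *)
Lemma sum_resample_kernel_weight_le q x s : 0 < q <= 1 ->
  \sum_(y : cube) (weight y == s)%:R * resample_kernel q x y <=
  (Num.sqrt (n.+1%:R * q))^-1.
Proof.
move=> /[dup] q01 /andP[q0 q1]; apply: le_trans (inverse_sqrt_moment q01).
rewrite (sum_weight_eq (fun i b => resample q (x i) b)).
(* Each factor is split according to whether bit i is resampled: a fresh fair bit has generating
   function [(1 + 'X)/2], a kept one ['X^(x i)]. *)
pose G i (b : bool) : {poly R} :=
  bernoulli_pmf q b *: (if b then 2^-1 *: (1 + 'X) else 'X^(x i)).
have -> : \prod_i ((resample q (x i) false)%:P + resample q (x i) true *: 'X) =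
    \prod_i \sum_b G i b.
  apply: eq_bigr => i _; rewrite big_bool /G /resample /bernoulli_pmf scalerA.
  rewrite -!mul_polyC.
  case: (x i); rewrite /= ?expr0 ?expr1 ?mulr1 ?mulr0 ?add0r !polyCD ?polyCM ?polyCB; ring.
rewrite bigA_distr_bigA coef_sum; apply: ler_sum => r _.
rewrite scaler_prod coefZ -/(product_pmf q r).
apply: ler_wpM2l; first by rewrite product_pmf_ge0// (ltW q0).
have -> : \prod_i (if r i then 2^-1 *: (1 + 'X) else 'X^(x i)) =
    ((2 ^+ weight r)^-1 *: (1 + 'X) ^+ weight r) *
    'X^(\sum_i ~~ r i * x i)%N :> {poly R}.
  rewrite -exprVn -exprZn -!prodrXr -big_split /=; apply: eq_bigr => i _.
  by case: (r i) => /=; rewrite ?expr0 ?expr1 ?mulr1 ?mul1r// mul1n.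
(* The kept ones shift the index; below the shift the coefficient is 0, above it is a binomial
   probability. *)
rewrite coefMXn; case: ifP => _.
  by rewrite invr_ge0 sqrtr_ge0.
by rewrite coefZ coef_1DXn mulrC bin_prob_le.
Qed.

Lemma sum_prod_pair (F : 'I_n -> bool -> bool -> R) :
  \sum_(x : cube) \sum_(y : cube) \prod_i F i (x i) (y i) = \prod_i \sum_a \sum_b F i a b.
Proof.
rewrite bigA_distr_bigA; apply: eq_bigr => x _.
by rewrite (bigA_distr_bigA (fun i b => F i (x i) b)).
Qed.

(** Additivity of variance: when the pairs [(x i, y i)] are independent of law [u], the terms
    [d (x i) (y i)] are centred, so the cross terms vanish. *)
Lemma sum_prod_pair_sqr (u d : bool -> bool -> R) :
  \sum_a \sum_b u a b = 1 -> \sum_a \sum_b u a b * d a b = 0 ->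
  \sum_(x : cube) \sum_(y : cube) \prod_i u (x i) (y i) * (\sum_i d (x i) (y i)) ^+ 2 =
  n%:R * \sum_a \sum_b u a b * d a b ^+ 2.
Proof.
move=> u1 ud0.
under eq_bigr => x _ do under eq_bigr => y _ do
  rewrite expr2 mulr_suml mulr_sumr.
under eq_bigr => x _ do rewrite exchange_big.
rewrite exchange_big /=.
transitivity (\sum_(i < n) \sum_a \sum_b u a b * d a b ^+ 2); last first.
  by rewrite sumr_const card_ord mulr_natl.
apply: eq_bigr => i _.
under eq_bigr => x _ do under eq_bigr => y _ do rewrite mulr_sumr mulr_sumr.
under eq_bigr => x _ do rewrite exchange_big.
rewrite exchange_big /= (bigD1 i)//= [X in _ + X]big1 ?addr0 => [|j ji].
  pose F l a b := u a b * (if l == i then d a b ^+ 2 else 1).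
  transitivity (\sum_(x : cube) \sum_(y : cube) \prod_l F l (x l) (y l)).
    apply: eq_bigr => x _; apply: eq_bigr => y _.
    by rewrite /F big_split/= -big_mkcond big_pred1_eq.
  rewrite sum_prod_pair (bigD1 i)//= [X in _ * X]big1 => [|l /negbTE li].
    by rewrite mulr1 /F eqxx.
  rewrite -[RHS]u1 /F li; apply: eq_bigr => a _; apply: eq_bigr => b _.
  by rewrite mulr1.
(* For distinct i and j the product factorizes over coordinates, and the factor at i is the mean of
   [d], which is 0. *)
pose F l a b := u a b * (if l == i then d a b else 1) * (if l == j then d a b else 1).
transitivity (\sum_(x : cube) \sum_(y : cube) \prod_l F l (x l) (y l)).
  apply: eq_bigr => x _; apply: eq_bigr => y _.
  by rewrite /F !big_split/= -!big_mkcond !big_pred1_eq mulrA.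
rewrite sum_prod_pair (bigD1 i)//= [X in X * _](_ : _ = 0) ?mul0r//.
rewrite -[RHS]ud0 /F eqxx eq_sym (negbTE ji).
by apply: eq_bigr => a _; apply: eq_bigr => b _; rewrite mulr1.
Qed.

(** From fair bits, the difference at one coordinate is centred, and its square has mean [q / 2],
    the probability that the bit changes. *)
Lemma weight_diff_sqr q :
  \sum_(x : cube) \sum_(y : cube) resample_kernel q x y / 2 ^+ n *
    ((weight x)%:R - (weight y)%:R) ^+ 2 = n%:R * (q / 2).
Proof.
pose u a b : R := 2^-1 * resample q a b.
pose d (a b : bool) : R := a%:R - b%:R.
transitivity (\sum_(x : cube) \sum_(y : cube) \prod_i u (x i) (y i) * (\sum_i d (x i) (y i)) ^+ 2).
  apply: eq_bigr => x _; apply: eq_bigr => y _; congr (_ * _).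
    by rewrite big_split/= prodr_const card_ord exprVn mulrC.
  by rewrite /d sumrB /weight !natr_sum.
rewrite sum_prod_pair_sqr !big_bool /u /d /resample /=; first by field.
  by field.
by field.
Qed.

(** Summing out the mask and the fresh bits turns the noise of the stability definition into the
    kernel that also drives the dynamics. *)
Lemma disagreement_resample_kernel (f : boolean_function n) q :
  disagreement_probability f 2^-1 q =
  \sum_(x : cube) \sum_(y : cube) (f x != f y)%:R * (resample_kernel q x y / 2 ^+ n).
Proof.
apply: eq_bigr => x _.
transitivity (\sum_(r : cube) \sum_(z : cube) \sum_(y : cube) (f x != f y)%:R * ((2 ^+ n)^-1 *
    (product_pmf q r * product_pmf 2^-1 z * (y == rerandomize x r z)%:R))).
  apply: eq_bigr => r _; rewrite big_mkcond; apply: eq_bigr => z _ /=.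
  rewrite (bigD1 (rerandomize x r z))//= eqxx big1 ?addr0 => [|y /negbTE ->].
    by case: ifP => _; rewrite ?mul0r// mul1r mulr1 product_pmf_half mulrA.
  by rewrite !mulr0.
under eq_bigr do rewrite exchange_big; rewrite exchange_big /=.
apply: eq_bigr => y _; under eq_bigr do rewrite -mulr_sumr -mulr_sumr.
rewrite -mulr_sumr -mulr_sumr mulrC [in RHS]mulrC [_ / _]mulrC; congr (_ * _ * _).
rewrite /resample_kernel.
(* The indicator of [y == rerandomize x r z] is a product of indicators over the coordinates, so the
   sum over [r] and [z] factorizes. *)
transitivity (\sum_(r : cube) \sum_(z : cube) \prod_i (bernoulli_pmf q (r i) *
  bernoulli_pmf 2^-1 (z i) * (y i == if r i then z i else x i)%:R)).
  apply: eq_bigr => r _; apply: eq_bigr => z _; rewrite !big_split; congr (_ * _).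
  case: eqP => [->|ney].
    by rewrite big1// => i _; rewrite ffunE eqxx.
  have /existsP[i yi] : [exists i, y i != rerandomize x r z i].
    apply: contra_notT ney; rewrite negb_exists => /forallP ey.
    by apply/ffunP => i; have := ey i; rewrite negbK => /eqP.
  by rewrite (bigD1 i)//=; move: yi; rewrite ffunE => /negbTE ->; rewrite mul0r.
rewrite (sum_prod_pair (fun i a b => bernoulli_pmf q a * bernoulli_pmf 2^-1 b *
  (y i == if a then b else x i)%:R)).
apply: eq_bigr => i _; rewrite !big_bool /bernoulli_pmf /resample.
by case: (x i); case: (y i) => /=; field.
Qed.

End cube.

(** * Majority on the cube *)

Section majority.
Context {R : realType}.
Implicit Types (n k s : nat) (q : R).

Lemma weight_prob_le n s :
  \sum_(x : {ffun 'I_n -> bool}) (weight x == s)%:R / 2 ^+ n <=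
  (Num.sqrt n.+1%:R)^-1 :> R.
Proof. by rewrite -mulr_suml sum_cube_weight_eq bin_prob_le. Qed.

Lemma MAJ_weight k (x : {ffun 'I_k.*2.+1 -> bool}) :
  MAJ k.*2.+1 x = (k < weight x)%N.
Proof. by rewrite /MAJ (_ : (k.*2.+2)./2 = k.+1)//; lia. Qed.

(** The first sum indicates that the weight of [x] is between [k+1-J] and [k+J], written additively
    to avoid truncated subtraction. Outside this window a disagreement forces a weight difference of
    at least [J+1]. *)
Lemma MAJ_neq_le k J (x y : {ffun 'I_k.*2.+1 -> bool}) :
  (MAJ k.*2.+1 x != MAJ k.*2.+1 y)%:R <=
  \sum_(i < J.*2) (weight x + J == k.+1 + i)%N%:R +
  ((weight x)%:R - (weight y)%:R) ^+ 2 / J.+1%:R ^+ 2 :> R.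
Proof.
have s0 : 0 <= \sum_(i < J.*2) (weight x + J == k.+1 + i)%N%:R :> R by exact: sumr_ge0.
have d0 : 0 <= ((weight x)%:R - (weight y)%:R) ^+ 2 / J.+1%:R ^+ 2 :> R.
  by rewrite mulr_ge0 ?invr_ge0 ?sqr_ge0.
rewrite !MAJ_weight; have [/eqP _|neq] := boolP (_ == _); first exact: addr_ge0.
have [/andP[lx xl]|far] := boolP (k < weight x + J <= k + J.*2)%N.
  have ij : (weight x + J - k.+1 < J.*2)%N by lia.
  rewrite -[leLHS]addr0 lerD// (bigD1 (Ordinal ij))//= (_ : _ == _)%N; last by lia.
  by rewrite lerDl sumr_ge0.
rewrite -[leLHS]add0r lerD//.
rewrite ler_pdivlMr ?exprn_gt0 ?ltr0n// mul1r.
rewrite -[leRHS]real_normK ?num_real// lerXn2r ?nnegrE ?ler0n ?normr_ge0//.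
have [xy|xy] := leqP (weight x) (weight y).
  rewrite distrC ger0_norm ?subr_ge0 ?ler_nat// lerBrDr -natrD ler_nat.
  by move: neq; case: ltnP; case: ltnP => //; lia.
rewrite ger0_norm ?subr_ge0 ?ler_nat ?(ltnW xy)// lerBrDr -natrD ler_nat.
by move: neq; case: ltnP; case: ltnP => //; lia.
Qed.

Lemma disagreement_MAJ_le k J q : 0 <= q <= 1 ->
  disagreement_probability (MAJ k.*2.+1) 2^-1 q <=
  J.*2%:R / Num.sqrt k.*2.+2%:R + k.*2.+1%:R * (q / 2) / J.+1%:R ^+ 2.
Proof.
move=> q01; rewrite disagreement_resample_kernel -weight_diff_sqr.
apply: (@le_trans _ _ (\sum_(x : {ffun 'I_k.*2.+1 -> bool})
    \sum_(y : {ffun 'I_k.*2.+1 -> bool})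
    (\sum_(i < J.*2) (weight x + J == k.+1 + i)%N%:R +
     ((weight x)%:R - (weight y)%:R) ^+ 2 / J.+1%:R ^+ 2) *
    (resample_kernel q x y / 2 ^+ k.*2.+1))).
  apply: ler_sum => x _; apply: ler_sum => y _; apply: ler_wpM2r.
    by rewrite divr_ge0 ?resample_kernel_ge0 ?exprn_ge0.
  exact: MAJ_neq_le.
under eq_bigr => x _ do under eq_bigr => y _ do rewrite mulrDl.
under eq_bigr => x _ do rewrite big_split.
rewrite big_split/= lerD//; last first.
  rewrite mulr_suml le_eqVlt; apply/orP; left; apply/eqP.
  apply: eq_bigr => x _; rewrite mulr_suml; apply: eq_bigr => y _.
  by rewrite mulrAC [_ ^+ 2 * _]mulrC.
under eq_bigr => x _ do rewrite -mulr_sumr -mulr_suml sum_resample_kernel mul1r mulr_suml.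
rewrite exchange_big /= -[J.*2 in leRHS]card_ord mulr_natl -sumr_const.
apply: ler_sum => i _.
(* If the subtraction truncates because [J > k+1+i], the event on the left is empty, so the bound
   still holds. *)
apply: (le_trans _ (weight_prob_le k.*2.+1 (k.+1 + i - J))).
apply: ler_sum => x _; apply: ler_wpM2r; first by rewrite invr_ge0 exprn_ge0.
by rewrite ler_nat; case: eqP => // e; rewrite (_ : weight x == _)//; lia.
Qed.

Lemma MAJ_noise_stable :
  noise_stable (fun k : nat => MAJ k.*2.+1) (fun _ : nat => 2^-1 : R).
Proof.
(* With [J] the integer part of [a * sqrt n], the window costs at most [2a = delta/2], and the
   Chebyshev term at most [q/(2a^2)], which is at most [delta/2] once [q <= delta * a^2]. *)
move=> delta d0; pose a := delta / 4.
have a0 : 0 < a by rewrite divr_gt0.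
have q0 : 0 < Num.min 1 (delta * a ^+ 2) by rewrite lt_min ltr01 mulr_gt0 ?exprn_gt0.
have q1 : Num.min 1 (delta * a ^+ 2) <= 1 by rewrite ge_min lexx.
have qa : Num.min 1 (delta * a ^+ 2) <= delta * a ^+ 2 by rewrite ge_min lexx orbT.
move: (Num.min _ _) => q in q0 q1 qa *.
exists q; first by rewrite q0.
apply: ge_ereal_sup => _ [k _ <-]; rewrite lee_fin.
pose n : R := k.*2.+1%:R; have n0 : 0 < n by rewrite ltr0n.
have sn0 : 0 < Num.sqrt n by rewrite sqrtr_gt0.
pose J := Num.truncn (a * Num.sqrt n).
have /andP[Jle Jlt] := truncn_itv (mulr_ge0 (ltW a0) (ltW sn0)).
rewrite -/J in Jle Jlt.
have q01 : 0 <= q <= 1 by rewrite (ltW q0).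
apply: (le_trans (disagreement_MAJ_le k J q01)).
have -> : delta = 2 * a + delta / 2 by rewrite /a; field.
apply: lerD.
  rewrite ler_pdivrMr ?sqrtr_gt0 ?ltr0n// -mul2n natrM -mulrA ler_wpM2l//.
  apply: (le_trans Jle); rewrite ler_wpM2l ?(ltW a0)// ler_sqrt ?ltr0n// /n ler_nat//.
rewrite ler_pdivrMr ?exprn_gt0 ?ltr0n//.
apply: (@le_trans _ _ (delta / 2 * (a * Num.sqrt n) ^+ 2)).
  rewrite exprMn sqr_sqrtr ?(ltW n0)// [leRHS]mulrA [leLHS]mulrC -/n ler_wpM2r ?(ltW n0)//.
  by rewrite mulrAC ler_wpM2r ?invr_ge0.
apply: ler_wpM2l; first by rewrite divr_ge0 ?(ltW d0).
by rewrite lerXn2r ?nnegrE ?mulr_ge0 ?ler0n ?(ltW a0) ?(ltW sn0)// ltW.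
Qed.

Lemma bernoulli_inequality (a : R) m :
  0 <= a <= 1 -> 1 - m%:R * a <= (1 - a) ^+ m.
Proof.
move=> /andP[a0 a1]; elim: m => [|m IH]; first by rewrite mul0r subr0.
rewrite exprS; have a1' : 0 <= 1 - a by rewrite subr_ge0.
apply: le_trans (ler_wpM2l a1' IH); rewrite -subr_ge0 -natr1.
rewrite [leRHS](_ : _ = m%:R * a ^+ 2); last by ring.
by rewrite mulr_ge0 ?sqr_ge0.
Qed.

Definition flip n (x : {ffun 'I_n -> bool}) (i : 'I_n) : {ffun 'I_n -> bool} :=
  [ffun j => x j (+) (j == i)].

Lemma flip_inj n (x : {ffun 'I_n -> bool}) : injective (flip x).
Proof.
move=> i j /ffunP /(_ i); rewrite !ffunE eqxx => /addbI/esym/eqP.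
by [].
Qed.

Lemma weight_flip n (x : {ffun 'I_n -> bool}) i : x i -> weight x = (weight (flip x i)).+1.
Proof.
move=> xi; rewrite /weight (bigD1 i)//= [in RHS](bigD1 i)//= ffunE xi eqxx /=.
rewrite add1n add0n; congr _.+1; apply: eq_bigr => j /negbTE ji.
by rewrite ffunE ji addbF.
Qed.

Lemma resample_kernel_flip n (x : {ffun 'I_n -> bool}) i q :
  resample_kernel q x (flip x i) = q / 2 * (1 - q / 2) ^+ n.-1.
Proof.
rewrite /resample_kernel (bigD1 i)//=; congr (_ * _).
  by rewrite /resample ffunE eqxx; case: (x i) => /=; rewrite mulr0 add0r.
rewrite (eq_bigr (fun=> 1 - q / 2)) => [|j /negbTE ji].
  by rewrite prodr_const cardC1 card_ord.
by rewrite /resample ffunE ji addbF eqxx mulr1; field.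
Qed.

(* Only the configurations obtained by flipping a single 1 are counted. *)
Lemma crossing_prob_ge k (x : {ffun 'I_k.*2.+1 -> bool}) q :
  weight x = k.+1 -> (2 * k.*2.+1%:R)^-1 <= q <= k.*2.+1%:R^-1 ->
  16^-1 <= \sum_(y : {ffun 'I_k.*2.+1 -> bool})
             (weight y <= k)%N%:R * resample_kernel q x y.
Proof.
move=> xk /andP[ql qu]; set n : R := k.*2.+1%:R in ql qu *.
have n1 : 1 <= n by rewrite ler1n.
have n0 : 0 < n by lra.
have q0 : 0 <= q by apply: le_trans ql; rewrite invr_ge0 mulr_ge0 ?ltW.
have q1 : q <= 1 by apply: (le_trans qu); rewrite invf_le1.
have q01 : 0 <= q <= 1 by rewrite q0.
have nql : 1 <= 2 * n * q by rewrite mulrC -ler_pdivrMr ?mul1r ?mulr_gt0.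
have nqu : n * q <= 1 by rewrite mulrC -ler_pdivlMr ?mul1r.
apply: (@le_trans _ _ (\sum_(y in [set flip x i | i in [pred i | x i]]%SET)
   resample_kernel q x y)); last first.
  rewrite big_mkcond; apply: ler_sum => y _; case: ifP => [/imsetP[i]|_].
    rewrite inE => xi ->; rewrite (_ : (_ <= k)%N) ?mul1r//.
    by rewrite -ltnS -weight_flip// xk.
  by rewrite mulr_ge0 ?resample_kernel_ge0.
rewrite big_imset /=; last by move=> i j _ _; exact: flip_inj.
under eq_bigr do rewrite resample_kernel_flip.
rewrite sumr_const (_ : #|_| = k.+1); last first.
  rewrite -xk /weight -sum1_card [LHS]big_mkcond.
  by apply: eq_bigr => i _; rewrite inE; case: (x i).
(* As [nq <= 1], Bernoulli's inequality bounds the power below by 1/2; then [k+1 >= n/2] and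
   [nq >= 1/2] give [(k+1)q/4 >= 1/16]. *)
have /(le_trans _)-> // : k.+1%:R * (q / 2 * 2^-1) <= q / 2 * (1 - q / 2) ^+ k.*2.+1.-1 *+ k.+1.
  rewrite -[leRHS]mulr_natl !ler_wpM2l ?divr_ge0//.
  apply: (le_trans _ (bernoulli_inequality _ _)); last by lra.
  have : k.*2%:R * q <= n * q by rewrite ler_wpM2r// ler_nat.
  by rewrite /=; lra.
have : n <= 2 * k.+1%:R by rewrite -natrM ler_nat; lia.
move=> /(ler_wpM2r q0); lra.
Qed.

(** The level [k+1] has mass at least [1/(2 sqrt n)], and each of its points crosses with
    probability at least 1/16. The range of [q] is the one produced by a time step [1/n]. *)
Lemma stationary_crossing_prob_ge k q :
  (2 * k.*2.+1%:R)^-1 <= q <= k.*2.+1%:R^-1 ->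
  (32 * Num.sqrt k.*2.+1%:R)^-1 <=
  \sum_(x : {ffun 'I_k.*2.+1 -> bool}) \sum_(y : {ffun 'I_k.*2.+1 -> bool})
    ((weight x == k.+1) && (weight y <= k)%N)%:R *
    (resample_kernel q x y / 2 ^+ k.*2.+1).
Proof.
move=> hq; apply: (@le_trans _ _ (16^-1 * \sum_(x : {ffun 'I_k.*2.+1 -> bool})
   (weight x == k.+1)%:R / 2 ^+ k.*2.+1)).
  rewrite -mulr_suml sum_cube_weight_eq.
  rewrite (_ : 32 = 16 * 2); last by ring.
  rewrite -mulrA invfM ler_wpM2l ?invr_ge0//.
  apply: (le_trans _ (middle_bin_prob_ge k)).
  rewrite lef_pV2 ?posrE ?mulr_gt0 ?sqrtr_gt0 ?ltr0n// ler_wpM2l// ler_sqrt ?ltr0n// ler_nat.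
  by lia.
rewrite mulr_sumr; apply: ler_sum => x _.
have [xk|_] := eqVneq (weight x) k.+1; last first.
  by rewrite mul0r mulr0 sumr_ge0// => y _; rewrite mul0r.
under eq_bigr do rewrite /= mulrA; rewrite -mulr_suml mul1r.
by rewrite ler_wpM2r ?invr_ge0 ?exprn_ge0// crossing_prob_ge.
Qed.

Lemma stationary_return_prob_le n s m q : (m <= n)%N ->
  m%:R / (2 * n%:R) <= q <= 1 ->
  \sum_(x : {ffun 'I_n -> bool}) \sum_(y : {ffun 'I_n -> bool})
    ((weight x == s) && (weight y == s))%:R * (resample_kernel q x y / 2 ^+ n) <=
  (Num.sqrt n.+1%:R)^-1 * (2 / Num.sqrt m.+1%:R).
Proof.
move=> mn /andP[ql q1].
have q0 : 0 <= q by apply: le_trans ql; rewrite divr_ge0 ?mulr_ge0.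
apply: (@le_trans _ _ ((\sum_(x : {ffun 'I_n -> bool}) (weight x == s)%:R / 2 ^+ n) *
   (2 / Num.sqrt m.+1%:R))); last first.
  by rewrite ler_wpM2r ?weight_prob_le// divr_ge0 ?sqrtr_ge0.
rewrite mulr_suml; apply: ler_sum => x _.
under eq_bigr do rewrite -mulnb natrM [_ / _]mulrC mulrACA.
rewrite -mulr_sumr ler_wpM2l ?divr_ge0 ?exprn_ge0//.
(* At lag 0 [q] may vanish, and the total mass 1 of the kernel is used as the bound. *)
have [->|m0] := eqVneq m 0.
  rewrite sqrtr1 divr1.
  apply: (@le_trans _ _ (\sum_(y : {ffun 'I_n -> bool}) resample_kernel q x y)).
    apply: ler_sum => y _; rewrite ler_piMl ?resample_kernel_ge0 ?q0//.
    by case: (_ == _).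
  by rewrite sum_resample_kernel ler1n.
have m1 : 1 <= m%:R :> R by rewrite ler1n lt0n.
have mn' : m%:R <= n%:R :> R by rewrite ler_nat.
have n0 : 0 < n%:R :> R by lra.
(* For [m >= 1] this yields [(n+1)q >= m/2 >= (m+1)/4], whence the factor 2 in the bound. *)
have qm : m%:R <= 2 * n%:R * q by move: ql; rewrite ler_pdivrMr ?mulr_gt0// mulrC.
have q0' : 0 < q.
  by apply: lt_le_trans ql; rewrite divr_gt0 ?mulr_gt0// (lt_le_trans ltr01).
apply: (le_trans (sum_resample_kernel_weight_le _ _ _)); first by rewrite q0'.
have sm0 : 0 < Num.sqrt m.+1%:R :> R by rewrite sqrtr_gt0.
rewrite -[leRHS]invf_div lef_pV2 ?posrE ?divr_gt0 ?sqrtr_gt0 ?mulr_gt0//.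
rewrite ler_pdivrMr// -(@ler_pXn2r _ 2) ?nnegrE ?mulr_ge0 ?sqrtr_ge0//.
rewrite exprMn !sqr_sqrtr ?mulr_ge0// -!natr1 mulrDl mul1r.
by lra.
Qed.

(** Telescoping: [2/sqrt(i+1) <= 4(sqrt(i+1) - sqrt i)]. *)
Lemma sum_inverse_sqrt_le m :
  \sum_(i < m) (2 / Num.sqrt i.+1%:R) <= 4 * Num.sqrt m%:R :> R.
Proof.
elim: m => [|m IH]; first by rewrite big_ord0 mulr_ge0 ?sqrtr_ge0.
rewrite big_ord_recr/=; apply: (le_trans (lerD IH (lexx _))).
set s := Num.sqrt m%:R; set t := Num.sqrt m.+1%:R.
have s0 : 0 <= s by rewrite sqrtr_ge0.
have t0 : 0 < t by rewrite sqrtr_gt0.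
have st : t ^+ 2 = s ^+ 2 + 1 by rewrite !sqr_sqrtr// natr1.
rewrite -lerBrDl ler_pdivrMr// mulrBl -subr_ge0.
rewrite [leRHS](_ : _ = 2 * (t - s) ^+ 2 + 2 * (t ^+ 2 - s ^+ 2 - 1)); last by ring.
by rewrite st; have := sqr_ge0 (t - s); lra.
Qed.

End majority.

(** * Jumps of cadlag boolean paths *)

Section paths.
Context {R : realType}.
Implicit Types (g : R -> bool) (t u v : R).

Lemma cvg_boolP (F : set_system R) {FF : Filter F} g (b : bool) :
  (g s @[s --> F] --> b) <-> (\forall s \near F, g s = b).
Proof. exact: (discrete_cvg (g s @[s --> F])). Qed.

Lemma cadlag_comp m (f : boolean_function m) (Y : 'I_m -> R -> bool) :
  (forall i, cadlag (Y i)) -> cadlag (fun t => f [ffun i => Y i t]).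
Proof.
move=> cY; split=> t t0.
  apply/cvg_boolP.
  have : \forall s \near t^'+, forall i, Y i s = Y i t.
    by apply: filter_forall => i; apply/cvg_boolP; apply: (cY i).1.
  by apply: filterS => s e; congr f; apply/ffunP => i; rewrite !ffunE.
have /choice[l ll] : forall i, exists b, \forall s \near t^'-, Y i s = b.
  move=> i; have /cvg_ex[b /cvg_boolP hb] := (cY i).2 t t0.
  by exists b.
apply/cvg_ex; exists (f [ffun i => l i]); apply/cvg_boolP.
have : \forall s \near t^'-, forall i, Y i s = l i by exact: filter_forall.
apply: filterS => s e.
by congr f; apply/ffunP => i; rewrite !ffunE.
Qed.

Definition jump g t : Prop := ~ (g s @[s --> t^'-] --> g t).

(** Without a jump, [g] read as a real function would be continuous on [[u, v]] and take the value
    1/2 by the intermediate value theorem. *)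
Lemma exists_jump g u v : cadlag g -> 0 <= u -> u < v -> g u != g v ->
  exists2 t, u < t <= v & jump g t.
Proof.
move=> [rc ll] u0 uv guv; apply: contrapT => nj.
have lc t : u < t <= v -> \forall s \near t^'-, g s = g t.
  by move=> ut; apply/cvg_boolP; apply: contrapT => jt; apply: nj; exists t.
have rc' t : u <= t -> \forall s \near t^'+, g s = g t.
  by move=> ut; apply/cvg_boolP; apply: rc; apply: le_trans ut.
pose h s : R := (g s)%:R.
have near_h (F : set_system R) (FF : Filter F) t :
    (\forall s \near F, g s = g t) -> h s @[s --> F] --> h t.
  by move=> e; apply: cvg_near_cst; apply: filterS e => s; rewrite /h => ->.
have [] := @IVT R h u v 2^-1 (ltW uv).
- apply/continuous_within_itvP => //; split.
  + move=> t; rewrite in_itv /= => /andP[ut tv]; apply/left_right_continuousP.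
    by split; apply: near_h; [apply: lc; rewrite ut ltW | apply: rc'; rewrite ltW].
  + by apply: near_h; apply: rc'.
  + by apply: near_h; apply: lc; rewrite uv lexx.
- rewrite /h; case: (g u) (g v) guv => [] [] //= _.
    by rewrite min_r ?ler01// max_l ?ler01//; lra.
  by rewrite min_l ?ler01// max_r ?ler01//; lra.
- by move=> c _; rewrite /h; case: (g c) => /=; lra.
Qed.

(** One-sided limits of a boolean path are eventual values, and at a jump the left one differs from
    [g t]. Every smaller radius is allowed so that finitely many jumps can share one. *)
Lemma jump_isolated g t : cadlag g -> 0 < t -> jump g t ->
  exists2 e : R, 0 < e & forall e', e' <= e ->
    (forall s, t - e' < s < t -> g s != g t) /\
    (forall s, t <= s < t + e' -> g s = g t).
Proof.
move=> [rc ll] t0 jt.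
have /cvg_ex[b /cvg_boolP hb] := ll t t0.
have /cvg_boolP hr := rc t (ltW t0).
have bt : b != g t.
  by apply/eqP => e; apply: jt; apply/cvg_boolP; rewrite -e.
case: hb => e1 /= e10 h1; case: hr => e2 /= e20 h2.
exists (Num.min e1 e2); first by rewrite lt_min e10.
move=> e'; rewrite le_min => /andP[ee1 ee2]; split=> s.
  move=> /andP[ts st]; rewrite h1//= gtr0_norm ?subr_gt0//.
  by apply: lt_le_trans ee1; lra.
rewrite le_eqVlt => /andP[/predU1P[->//|ts] st].
rewrite h2//= distrC gtr0_norm ?subr_gt0//.
by apply: lt_le_trans ee2; lra.
Qed.

Lemma jumps_isolated g (l : seq R) : cadlag g ->
  (forall t, t \in l -> 0 < t /\ jump g t) ->
  exists2 e : R, 0 < e & forall t, t \in l ->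
    (forall s, t - e < s < t -> g s != g t) /\
    (forall s, t <= s < t + e -> g s = g t).
Proof.
move=> cg jl; suff [e e0 he] : exists2 e : R, 0 < e & forall e', e' <= e ->
    forall t, t \in l -> (forall s, t - e' < s < t -> g s != g t) /\
      (forall s, t <= s < t + e' -> g s = g t).
  by exists e => //; apply: he.
elim: l jl => [|t l IH] jl; first by exists 1.
have [|e1 e10 h1] := IH; first by move=> s sl; apply: jl; rewrite inE sl orbT.
have [t0 jt] := jl t (mem_head _ _).
have [e2 e20 h2] := jump_isolated cg t0 jt.
exists (Num.min e1 e2); first by rewrite lt_min e10.
move=> e'; rewrite le_min => /andP[ee1 ee2] s; rewrite inE => /predU1P[->|sl].
  exact: h2.
exact: h1.
Qed.

Definition grid_changes (N : nat) g : nat :=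
  (\sum_(j < N) (g (j%:R / N%:R) != g (j.+1%:R / N%:R)))%N.

Lemma grid_changesE N g :
  grid_changes N g = #|[pred j : 'I_N | g (j%:R / N%:R) != g (j.+1%:R / N%:R)]|.
Proof.
rewrite /grid_changes -sum1_card [RHS]big_mkcond.
by apply: eq_bigr => i _; rewrite inE; case: ifP.
Qed.

(** Every grid cell whose endpoints have different values contains a jump, and the cells are
    disjoint. *)
Lemma grid_changes_le N g : cadlag g ->
  ((grid_changes N.+1 g)%:R%:E <= number_of_changes g)%E.
Proof.
move=> cg; rewrite /number_of_changes /counting.
case: asboolP => [fin|_]; last by rewrite leey.
rewrite lee_fin ler_nat grid_changesE.
set A := [pred j : 'I_N.+1 | _].
have N0 : 0 < N.+1%:R :> R by rewrite ltr0n.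
have /choice[tau htau] : forall j : 'I_N.+1, exists t, A j ->
    j%:R / N.+1%:R < t <= j.+1%:R / N.+1%:R /\ jump g t.
  move=> j; have [Aj|nAj] := boolP (A j); last by exists 0.
  have [|||t tj jt] := @exists_jump g (j%:R / N.+1%:R) (j.+1%:R / N.+1%:R) cg.
  - by rewrite divr_ge0.
  - by rewrite ltr_pM2r ?invr_gt0// ltr_nat.
  - exact: Aj.
  - by exists t.
have -> : #|A| = size [seq tau j | j <- enum A] by rewrite size_map -cardE.
apply: uniq_leq_size.
  rewrite map_inj_in_uniq ?enum_uniq// => i j.
  rewrite !mem_enum => Ai Aj e; apply: val_inj.
  have [/andP[il ir] _] := htau i Ai; have [/andP[jl jr] _] := htau j Aj.
  rewrite e in il ir; have := lt_le_trans il jr; have := lt_le_trans jl ir.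
  rewrite !ltr_pM2r ?invr_gt0// !ltr_nat /=; lia.
move=> t /mapP[j]; rewrite mem_enum => Aj ->.
have [/andP[jl jr] jt] := htau j Aj.
rewrite in_fset_set// inE /=; split=> //; apply/andP; split.
  by apply: le_lt_trans jl; rewrite divr_ge0.
apply: (le_trans jr); rewrite ler_pdivrMr// mul1r ler_nat.
exact: ltn_ord.
Qed.

Lemma grid_interval N t : 0 < t <= 1 ->
  exists j : 'I_N.+1, j%:R / N.+1%:R < t <= j.+1%:R / N.+1%:R.
Proof.
have N0 : 0 < N.+1%:R :> R by rewrite ltr0n.
move=> /andP[t0 t1].
have ex : exists j, t * N.+1%:R <= j.+1%:R.
  by exists N; rewrite ler_piMl// ltW.
case: (ex_minnP ex) => j tj jmin.
have jN : (j < N.+1)%N.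
  by rewrite ltnS; apply: jmin; rewrite ler_piMl// ltW.
exists (Ordinal jN) => /=; rewrite ler_pdivlMr// tj andbT ltr_pdivrMr//.
case: j jmin {tj jN} => [|j] jmin; first by rewrite mulr_gt0.
by rewrite ltNge; apply/negP => /jmin; rewrite ltnn.
Qed.

(** Finitely many jumps are already more than [M]; a mesh below their common isolation radius puts
    them in distinct cells and shows a change in each. With [grid_changes_le] this makes exceeding
    [M] a countable union of grid events. *)
Lemma grid_changes_gt g (M : R) : cadlag g -> (M%:E < number_of_changes g)%E ->
  exists N, M < (grid_changes N.+1 g)%:R.
Proof.
move=> cg; rewrite /number_of_changes; set J := [set t | _] => MJ.
have [B [uB hB MB]] : exists B : seq R,
    [/\ uniq B, forall t, t \in B -> 0 < t <= 1 /\ jump g t & M < (size B)%:R].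
  move: MJ; rewrite /counting; case: asboolP => [fin|inf] MJ.
    exists (finmap.enum_fset (fset_set J)); split; [exact: finmap.fset_uniq| |by rewrite -lte_fin].
    by move=> t /=; rewrite in_fset_set// inE.
  have [B BJ hB] := infinite_set_fset (Num.truncn M).+1 inf.
  exists (finmap.enum_fset B); split; [exact: finmap.fset_uniq|by move=> t /BJ|].
  by apply: lt_le_trans (truncnS_gt M) _; rewrite ler_nat.
have [e e0 he] : exists2 e : R, 0 < e & forall t, t \in B ->
    (forall s, t - e < s < t -> g s != g t) /\
    (forall s, t <= s < t + e -> g s = g t).
  by apply: jumps_isolated => // t /hB[/andP[-> _] ?].
pose N := Num.truncn e^-1; have Ne : N.+1%:R^-1 < e.
  by rewrite -[ltRHS]invrK ltf_pV2 ?posrE ?invr_gt0// truncnS_gt.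
exists N; apply: lt_le_trans MB _; rewrite ler_nat grid_changesE.
have N0 : 0 < N.+1%:R :> R by rewrite ltr0n.
have step (j : nat) : j.+1%:R / N.+1%:R = j%:R / N.+1%:R + N.+1%:R^-1 :> R.
  by rewrite -natr1 mulrDl mul1r.
have /choice[iota hiota] : forall t, exists j : 'I_N.+1, t \in B ->
    j%:R / N.+1%:R < t <= j.+1%:R / N.+1%:R.
  move=> t; have [/hB[t01 _]|_] := boolP (t \in B); last by exists ord0.
  by have [j hj] := grid_interval N t01; exists j.
rewrite -(size_map iota) cardE; apply: uniq_leq_size.
  rewrite map_inj_in_uniq //.
  (* Two jumps [s < t] in one cell are closer than [e], so [g s] would differ from [g t] by
     isolation of [t] and equal it by isolation of [s]. *)
  have lt_iota s t : s \in B -> t \in B -> s < t ->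
      iota s != iota t.
    move=> sB tB st; apply/eqP => ist.
    have := hiota s sB; have := hiota t tB; rewrite ist step.
    move=> /andP[_ tj] /andP[sj _].
    have [hs _] := he t tB; have [_ ht] := he s sB.
    have := hs s; rewrite st andbT => /(_ _)/eqP; apply.
      by move: tj sj Ne; move: (N.+1%:R^-1 : R) (_ / _) => b a; lra.
    by apply/esym/ht; rewrite (ltW st) /=; move: tj sj Ne; move: (N.+1%:R^-1 : R) (_ / _) => b a; lra.
  move=> s t sB tB e'; apply/eqP; case: ltgtP => // st.
    by have := lt_iota s t sB tB st; rewrite e' eqxx.
  by have := lt_iota t s tB sB st; rewrite e' eqxx.
move=> _ /mapP[t tB ->]; rewrite mem_enum inE.
have /andP[tl tr] := hiota t tB; have [hl hr] := he t tB.
(* The right end of the cell lies in [[t, t + e)], where [g] equals [g t], and the left end in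
   [(t - e, t)], where it does not. *)
rewrite step in tr *; rewrite (hr (_ + _)); last first.
  by rewrite tr /=; move: tl tr Ne; move: (N.+1%:R^-1 : R) (_ / _) => b a; lra.
by apply: hl; rewrite tl andbT; move: tl tr Ne; move: (N.+1%:R^-1 : R) (_ / _) => b a; lra.
Qed.

End paths.

(** * A single bit *)

Section half_rate.
Context {R : realType}.
Implicit Types (t : R) (a b : bool).

(** Left unsimplified to be convertible with the rate in [dynamics] at [p = 1/2]. *)
Definition half_rate a : R := if a then 1 - 2^-1 else 2^-1.

(** The forward equation makes the row sum constant, as well as [expR t] times the difference of the
    two entries; these two invariants determine the row. *)
Lemma half_rate_transition pt t a b :
  transition_function (generator half_rate) pt ->
  pt t a b = resample (1 - expR (- t)) a b.
Proof.
move=> [pt0 dpt].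
have sum1 : pt t a true + pt t a false = 1.
  have -> : 1 = pt 0 a true + pt 0 a false by rewrite !pt0; case: (a); rewrite /= ?addr0 ?add0r.
  apply: (@is_derive_0_is_cst R (fun s => pt s a true + pt s a false)) => x.
  apply: (is_derive_eq (is_deriveD (dpt x a true) (dpt x a false))).
  by rewrite !big_bool /generator /half_rate /=; field.
have gap : expR t * (pt t a true - pt t a false) = (a : nat)%:R - (~~ a : nat)%:R.
  have -> : (a : nat)%:R - (~~ a : nat)%:R = expR 0 * (pt 0 a true - pt 0 a false).
    by rewrite expR0 mul1r !pt0; case: (a).
  apply: (@is_derive_0_is_cst R (fun s => expR s * (pt s a true - pt s a false))) => x.
  apply: (is_derive_eq (is_deriveM (is_derive_expR x)
    (is_deriveB (dpt x a true) (dpt x a false)))).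
  by rewrite !big_bool /generator /half_rate /= /GRing.scale /= ?fctE; field.
have gap' : pt t a true - pt t a false = expR (- t) * ((a : nat)%:R - (~~ a : nat)%:R).
  by rewrite -gap mulrA -expRD addNr expR0 mul1r.
by rewrite /resample; case: a b sum1 gap' {gap} => [] [] /=; lra.
Qed.

Lemma expRN_le t : 0 <= t -> expR (- t) <= (1 + t)^-1.
Proof.
move=> t0; rewrite expRN lef_pV2 ?posrE ?expR_gt0 ?expR_ge1Dx//.
by rewrite ltr_pwDl.
Qed.

(** The lower bound is [expR (- t) <= 1/(1+t) <= 1 - t/2], the last step using [t^2 <= t]. *)
Lemma resample_rate_bounds t : 0 <= t <= 1 -> t / 2 <= 1 - expR (- t) <= t.
Proof.
move=> /andP[t0 t1]; apply/andP; split; last first.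
  by have := expR_ge1Dx (- t); lra.
rewrite lerBrDl -lerBrDr; apply: (le_trans (expRN_le t0)).
have t10 : 0 < 1 + t by rewrite ltr_pwDl.
by rewrite -div1r ler_pdivrMr//; nra.
Qed.

End half_rate.

Section marginals.
Context {R : realType} {d : measure_display} {T : measurableType d}.
Variable P : probability T R.

Lemma half_rate_two_times (Y : R -> T -> bool) : markov_chain P half_rate Y ->
  forall (s t : R) a b, 0 <= s -> s <= t ->
  P (Y s @^-1` [set a] `&` Y t @^-1` [set b]) =
  (P (Y s @^-1` [set a]) * (resample (1 - expR (- (t - s))) a b)%:E)%E.
Proof.
move=> [_ _ [pt tpt fdd]] s t a b s0 st.
pose u (j : nat) : R := if j is _.+1 then t else s.
pose c (j : nat) : bool := if j is _.+1 then b else a.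
have := fdd 1%N u c s0 (fun j => _).
rewrite big_ord1 (half_rate_transition _ _ _ tpt) /= => <-; last by case.
congr (P _); apply/seteqP; split=> w /=.
  by move=> [h0 h1] [|[|j]].
by move=> h; split; [apply: (h 0%N) | apply: (h 1%N)].
Qed.

(** The one-time law comes from stationarity: invariance under the kernel of time 1 reads
    [(1 - e)(mu true - 1/2) = 0] with [e = expR (- 1) < 1]. *)
Lemma half_rate_law (Y : R -> T -> bool) : markov_chain P half_rate Y ->
  stationary P Y -> forall (t : R) a, 0 <= t -> P (Y t @^-1` [set a]) = (2^-1)%:E.
Proof.
move=> mcY sY t a t0; have two := half_rate_two_times mcY.
have [mY _ _] := mcY.
have mYa (s : R) b : 0 <= s -> measurable (Y s @^-1` [set b]).
  by move=> s0; rewrite -[_ @^-1` _]setTI; apply: mY.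
pose mu b := fine (P (Y 0 @^-1` [set b])).
have muE b : P (Y 0 @^-1` [set b]) = (mu b)%:E.
  by rewrite /mu fineK// fin_num_measure//; apply: mYa.
have shift (s : R) b : 0 <= s -> P (Y s @^-1` [set b]) = (mu b)%:E.
  move=> s0; rewrite -muE.
  have := sY s 0%N (fun=> 0) (fun=> b) s0 (fun _ _ => lexx _).
  set A := (X in P X = _); set B := (X in _ = P X).
  rewrite (_ : A = Y s @^-1` [set b]); last first.
    apply/seteqP; split=> w /=; first by move=> /(_ 0%N isT); rewrite add0r.
    by move=> h j _; rewrite add0r.
  rewrite (_ : B = Y 0 @^-1` [set b])//.
  by apply/seteqP; split=> w /=; [move=> /(_ 0%N isT) | move=> h j _].
have split_event (A : set T) : measurable A ->
    P A = (P (Y 0%R @^-1` [set true] `&` A) + P (Y 0%R @^-1` [set false] `&` A))%E.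
  move=> mA; rewrite -measureU.
  - congr (P _); apply/seteqP; split=> w /=; last by move=> [] [].
    by move=> Aw; case: (Y 0 w); [left|right].
  - by apply: measurableI => //; apply: mYa.
  - by apply: measurableI => //; apply: mYa.
  - by apply/seteqP; split=> w //= [[-> _] []].
have total : mu true + mu false = 1.
  have := split_event setT measurableT.
  by rewrite probability_setT !setIT !muE -EFinD => e; apply: EFin_inj; rewrite -e.
have := split_event (Y 1 @^-1` [set true]) (mYa 1 true ler01).
rewrite (shift 1 true ler01) !two// !muE -!EFinM -EFinD => inv; have {inv} := EFin_inj inv.
rewrite /resample /= mulr0 add0r subr0.
have e1 : expR (- 1) < 1 :> R by rewrite expR_lt1; lra.
move: (expR (- 1)) e1 => e e1 inv.
have half : mu true = 2^-1.
  have : (1 - e) * (mu true - 2^-1) = 0 by nra.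
  by move/eqP; rewrite mulf_eq0 => /orP[] /eqP; lra.
by rewrite (shift t a t0); congr (_%:E); case: a; lra.
Qed.

Lemma half_rate_joint_law (Y : R -> T -> bool) : markov_chain P half_rate Y ->
  stationary P Y -> forall (s t : R) a b, 0 <= s -> s <= t ->
  P (Y s @^-1` [set a] `&` Y t @^-1` [set b]) =
  (2^-1 * resample (1 - expR (- (t - s))) a b)%:E.
Proof.
by move=> mcY sY s t a b s0 st; rewrite half_rate_two_times// half_rate_law// EFinM.
Qed.

End marginals.

(** * Finite systems of bits *)

Section finite_expectations.
Context {R : realType} {d : measure_display} {T : measurableType d}.
Variable P : probability T R.

Lemma indic_bool (b : T -> bool) w : (b w)%:R = \1_[set w | b w] w :> R.
Proof. by rewrite indicE; congr (nat_of_bool _)%:R; apply/idP/idP; rewrite inE. Qed.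

Lemma measurable_fun_natr (b : T -> bool) :
  measurable [set w | b w] -> measurable_fun setT (fun w => (b w)%:R : R).
Proof.
move=> mb; rewrite (_ : (fun w => _) = \1_[set w | b w]) ?measurable_indic//.
by apply/funext => w; rewrite indic_bool.
Qed.

Lemma integral_sum_natr (I : finType) (b : I -> T -> bool) :
  (forall i, measurable [set w | b i w]) ->
  (\int[P]_w (\sum_i (b i w)%:R)%:E = \sum_i P [set w | b i w])%E.
Proof.
move=> mb; under eq_integral do rewrite -sumEFin.
rewrite ge0_integral_sum//.
- apply: eq_bigr => i _; under eq_integral do rewrite indic_bool.
  by rewrite integral_indic// setIT.
- by move=> i; apply/measurable_realfun.measurable_EFinP; exact: measurable_fun_natr.
Qed.

(** Expectation of a pointwise bound. In the application [b] runs over the crossings, [c] over the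
    pairs of grid times, and [B] is the event of more than [M] changes. *)
Lemma expectation_sum_le (I J : finType) (b : I -> T -> bool) (c : J -> T -> bool)
    (B : set T) (M u v : R) :
  (forall i, measurable [set w | b i w]) ->
  (forall j, measurable [set w | c j w]) -> measurable B ->
  0 <= M -> 0 <= u -> 0 <= v ->
  (forall w, \sum_i (b i w)%:R <= M + u * (\sum_j (c j w)%:R) + v * \1_B w) ->
  (\sum_i P [set w | b i w] <=
   M%:E + u%:E * (\sum_j P [set w | c j w]) + v%:E * P B)%E.
Proof.
move=> mb mc mB M0 u0 v0 le.
have mfun (K : finType) (f : K -> T -> bool) : (forall i, measurable [set w | f i w]) ->
    measurable_fun setT (fun w => (\sum_i (f i w)%:R : R)%:E).
  move=> mf; apply/measurable_realfun.measurable_EFinP.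
  by apply: measurable_sum => i; exact: measurable_fun_natr.
have mB1 : measurable_fun setT (fun w => (\1_B w : R)%:E).
  by apply/measurable_realfun.measurable_EFinP; exact: measurable_indic.
have s0 (K : finType) (f : K -> T -> bool) w : (0 <= (\sum_i (f i w)%:R : R)%:E)%E.
  by rewrite lee_fin sumr_ge0.
have B0 w : (0 <= (\1_B w : R)%:E)%E by rewrite lee_fin indicE.
have uS0 w : (0 <= u%:E * (\sum_j (c j w)%:R : R)%:E)%E by rewrite mule_ge0.
have vB0 w : (0 <= v%:E * (\1_B w : R)%:E)%E by rewrite mule_ge0.
have mcu : measurable_fun setT (fun w => u%:E * (\sum_j (c j w)%:R : R)%:E)%E.
  by apply: measurable_funeM; exact: mfun.
have mBv : measurable_fun setT (fun w => v%:E * (\1_B w : R)%:E)%E.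
  exact: measurable_funeM.
have -> : (M%:E + u%:E * (\sum_j P [set w | c j w]) + v%:E * P B =
    \int[P]_w (M%:E + u%:E * (\sum_j (c j w)%:R : R)%:E + v%:E * (\1_B w : R)%:E))%E.
  rewrite ge0_integralD//.
  - rewrite ge0_integralD//.
    rewrite !ge0_integralZl ?lee_fin//; last exact: mfun.
    rewrite integral_sum_natr// integral_indic// setIT.
    by rewrite integral_cst//= probability_setT mule1.
  - by move=> w _; rewrite adde_ge0.
  - exact: emeasurable_funD.
rewrite -(integral_sum_natr mb).
apply: ge0_le_integral => //.
- exact: mfun.
- by apply: emeasurable_funD => //; exact: emeasurable_funD.
- by move=> w _; rewrite -!EFinM -!EFinD lee_fin.
Qed.

End finite_expectations.

(** * Measurability of events about the whole configuration *)

Section state.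
Context {R : realType} {d : measure_display} {T : measurableType d}.
Variable P : probability T R.
Variables (n : nat) (X : 'I_n -> R -> T -> bool).

Definition state (t : R) (w : T) : {ffun 'I_n -> bool} := [ffun i => X i t w].

Lemma stateE t (x : {ffun 'I_n -> bool}) :
  [set w | state t w == x] = \bigcap_(i in [set: 'I_n]) X i t @^-1` [set x i].
Proof.
apply/seteqP; split=> w /=; first by move=> /eqP <- i _; rewrite /= ffunE.
by move=> h; apply/eqP/ffunP => i; rewrite ffunE; apply: h.
Qed.

Hypothesis mX : forall i t, 0 <= t -> measurable_fun setT (X i t).

Lemma measurable_bit i (t : R) b : 0 <= t -> measurable (X i t @^-1` [set b]).
Proof. by move=> t0; rewrite -[_ @^-1` _]setTI; apply: mX. Qed.

Lemma measurable_state t x : 0 <= t -> measurable [set w | state t w == x].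
Proof.
move=> t0; rewrite stateE; apply: fin_bigcap_measurable; first exact: finite_finset.
by move=> i _; exact: measurable_bit.
Qed.

Lemma measurable_state_pair s t (Q : rel {ffun 'I_n -> bool}) : 0 <= s -> 0 <= t ->
  measurable [set w | Q (state s w) (state t w)].
Proof.
move=> s0 t0; rewrite (_ : mkset _ = \bigcup_(p in [set p | Q p.1 p.2])
    ([set w | state s w == p.1] `&` [set w | state t w == p.2])).
  apply: fin_bigcup_measurable; first exact: finite_finset.
  by move=> p _; apply: measurableI; exact: measurable_state.
apply/seteqP; split=> w /=.
  by move=> Qst; exists (state s w, state t w) => //=; split; apply/eqP.
by move=> [[x y] /= Qxy [/eqP-> /eqP->]].
Qed.

(** The two grid lemmas write the event as a countable union of events that depend on finitely many
    times. *)
Lemma measurable_changes_gt (f : boolean_function n) (M : R) :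
  (forall i w, cadlag (fun t => X i t w)) ->
  measurable [set w | (M%:E < changes f X w)%E].
Proof.
move=> cX; pose g w t := f (state t w).
have cg w : cadlag (g w) by apply: cadlag_comp.
rewrite (_ : mkset _ = \bigcup_N [set w | M < (grid_changes N.+1 (g w))%:R]).
  apply: bigcupT_measurable => N.
  pose b (j : 'I_N.+1) w := g w (j%:R / N.+1%:R) != g w (j.+1%:R / N.+1%:R).
  have mb j : measurable [set w | b j w].
    apply: (@measurable_state_pair _ _ (fun x y => f x != f y)); exact: divr_ge0.
  rewrite (_ : mkset _ = (fun w => \sum_j (b j w)%:R) @^-1` `]M, +oo[%classic).
    rewrite -[_ @^-1` _]setTI; apply: measurable_sum => //.
    by move=> j; exact: measurable_fun_natr.
  by apply/seteqP; split=> w /=; rewrite in_itv /= andbT /grid_changes natr_sum.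
apply/seteqP; split=> w /=.
  by move=> /(grid_changes_gt (cg w))[N MN]; exists N.
by move=> [N _ MN]; apply: lt_le_trans (grid_changes_le N (cg w)); rewrite lte_fin.
Qed.

End state.

(** * Joint law of the configuration at two times *)

Section dynamics_law.
Context {R : realType} {d : measure_display} {T : measurableType d}.
Variable P : probability T R.
Variables (n : nat) (X : 'I_n -> R -> T -> bool).
Hypothesis dX : dynamics P 2^-1 X.

Lemma dynamics_measurable i t : 0 <= t -> measurable_fun setT (X i t).
Proof. by have [[+ _ _] _] := dX.1 i; apply. Qed.

Lemma dynamics_cadlag i w : cadlag (fun t => X i t w).
Proof. by have [[_ + _] _] := dX.1 i; apply. Qed.

Lemma state_joint_law (s t : R) x y : 0 <= s -> s <= t ->
  P [set w | (state X s w == x) && (state X t w == y)] =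
  (resample_kernel (1 - expR (- (t - s))) x y / 2 ^+ n)%:E.
Proof.
move=> s0 st; have t0 := le_trans s0 st.
pose A i := X i s @^-1` [set x i] `&` X i t @^-1` [set y i].
rewrite (_ : mkset _ = \bigcap_(i in [set: 'I_n]) A i); last first.
  rewrite bigcapI -!stateE.
  by apply/seteqP; split=> w /=; [move=> /andP | move=> [-> ->]].
rewrite dX.2 => [|i]; last first.
  pose G := [set B : set T | exists2 r : R, 0 <= r & exists C : set bool, B = X i r @^-1` C].
  have mG r C : 0 <= r -> <<s G >> (X i r @^-1` C).
    by move=> r0; apply: sub_sigma_algebra; exists r => //; exists C.
  exact: (@measurableI _ (g_sigma_algebraType G) _ _ (mG s _ s0) (mG t _ t0)).
rewrite mulrC -exprVn -[X in _ ^+ X]card_ord -prodr_const -big_split; congr (_%:E).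
apply: eq_bigr => i _; have [mcX sX] := dX.1 i.
by rewrite /A (half_rate_joint_law mcX sX)//.
Qed.

Lemma state_pair_prob (s t : R) (Q : rel {ffun 'I_n -> bool}) : 0 <= s -> s <= t ->
  P [set w | Q (state X s w) (state X t w)] =
  (\sum_(x : {ffun 'I_n -> bool}) \sum_(y : {ffun 'I_n -> bool}) (Q x y)%:R *
    (resample_kernel (1 - expR (- (t - s))) x y / 2 ^+ n))%:E.
Proof.
move=> s0 st; have t0 := le_trans s0 st.
pose b (p : {ffun 'I_n -> bool} * {ffun 'I_n -> bool}) w :=
  Q p.1 p.2 && ((state X s w == p.1) && (state X t w == p.2)).
have mX := dynamics_measurable.
have mQ := measurable_state_pair mX Q s0 t0.
have mb p : measurable [set w | b p w].
  exact: (measurable_state_pair mX (fun x y => Q p.1 p.2 && ((x == p.1) && (y == p.2))) s0 t0).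
have -> : P [set w | Q (state X s w) (state X t w)] = (\sum_p P [set w | b p w])%E.
  rewrite -integral_sum_natr//.
  (* A sum indexed by [unit] presents the single probability as an integral, to be compared
     pointwise with the sum over all pairs of configurations. *)
  have := @integral_sum_natr _ _ _ P unit (fun _ w => Q (state X s w) (state X t w)) (fun=> mQ).
  rewrite big_const card_unit /= addr0 => <-.
  apply: eq_integral => w _; congr (_%:E).
  rewrite big_const card_unit /= addr0 (bigD1 (state X s w, state X t w))//=.
  rewrite /b /= !eqxx !andbT big1 ?addr0// => -[x y] /= xy.
  case: andP => // -[_ /andP[/eqP ex /eqP ey]].
  by move: xy; rewrite -ex -ey eqxx.
rewrite (pair_bigA _ (fun x y => (Q x y)%:R * (resample_kernel _ x y / 2 ^+ n))) /=.
rewrite -sumEFin; apply: eq_bigr => -[x y] _ /=; rewrite /b /=.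
case: (Q x y) => /=; first by rewrite mul1r state_joint_law.
rewrite mul0r (_ : mkset _ = set0) ?measure0//.
by apply/seteqP; split=> w.
Qed.

End dynamics_law.

(** * Majority dynamics *)

Section pairs_of_times.
Context {R : realType}.

(** From [(v - c)^2 >= 0]; it replaces the Cauchy-Schwarz inequality in the second moment
    argument. *)
Lemma le_half_sqr (v w c : R) : 0 < c -> v ^+ 2 <= 2 * w -> v <= c^-1 * w + c / 2.
Proof.
move=> c0 vw; rewrite -(ler_pM2l c0) mulrDr mulVKf ?gt_eqF//.
have := sqr_ge0 (v - c); lra.
Qed.

(** Each product in the expanded square is charged to the ordering of its two indices; the diagonal
    is counted twice. *)
Lemma sqr_sum_bool_le n (b : 'I_n -> bool) :
  (\sum_i (b i)%:R) ^+ 2 <=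
  2 * \sum_(p : 'I_n * 'I_n) ((p.2 <= p.1)%N && (b p.2 && b p.1))%:R :> R.
Proof.
rewrite -(pair_bigA _ (fun i j : 'I_n => ((j <= i)%N && (b j && b i))%:R)) /=.
rewrite mulr_natl mulr2n [X in _ <= X + _]exchange_big -big_split /=.
rewrite expr2 mulr_suml; apply: ler_sum => i _.
rewrite mulr_sumr -big_split /=; apply: ler_sum => j _.
rewrite -natrM -natrD ler_nat.
by case/orP: (leq_total i j) => ->; case: (b i); case: (b j); rewrite ?leq_addr ?leq_addl.
Qed.

Lemma sum_lag_le n (g : nat -> R) (i : 'I_n) : (forall m, 0 <= g m) ->
  \sum_(j < n | (j <= i)%N) g (i - j)%N <= \sum_(m < n) g m.
Proof.
move=> g0; have iN : (i.+1 <= n)%N by [].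
rewrite -(big_ord_widen n (fun j => g (i - j)%N) iN).
rewrite (reindex_inj rev_ord_inj) /=.
rewrite (eq_bigr (fun j : 'I_i.+1 => g j)) => [|j _]; last by rewrite subSS subKn// -ltnS.
rewrite (big_ord_widen n g iN) big_mkcond; apply: ler_sum => j _.
by case: ifP.
Qed.

End pairs_of_times.

Section majority_dynamics.
Context {R : realType} {d : measure_display} {T : measurableType d}.
Variable P : probability T R.
Variables (k : nat) (X : 'I_k.*2.+1 -> R -> T -> bool).
Hypothesis dX : dynamics P 2^-1 X.

Local Notation n := k.*2.+1.
Local Notation time := (fun j : nat => j%:R / n%:R : R).

Let upcoming_change (j : 'I_n) (w : T) : bool :=
  (weight (state X (time j) w) == k.+1) && (weight (state X (time j.+1) w) <= k)%N.

(** Relaxes two upcoming changes to their starting weights, so that only the law at two times is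
    involved. *)
Let near_balance (p : 'I_n * 'I_n) (w : T) : bool :=
  (p.2 <= p.1)%N &&
  ((weight (state X (time p.2) w) == k.+1) && (weight (state X (time p.1) w) == k.+1)).

Let n0 : 0 < n%:R :> R. Proof. by rewrite ltr0n. Qed.

Let time_ge0 j : 0 <= time j. Proof. by rewrite divr_ge0. Qed.

Let le_time i j : (i <= j)%N -> time i <= time j.
Proof. by move=> ij; rewrite ler_pM2r ?invr_gt0// ler_nat. Qed.

Let time_diff i j : (i <= j)%N -> time j - time i = time (j - i)%N.
Proof. by move=> ij; rewrite /= natrB// mulrBl. Qed.

Let resample_time j : (j <= n)%N ->
  j%:R / (2 * n%:R) <= 1 - expR (- time j) <= time j.
Proof.
move=> jn; have -> : j%:R / (2 * n%:R) = time j / 2 :> R.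
  by rewrite invfM mulrCA mulrC.
by apply: resample_rate_bounds; rewrite time_ge0 ler_pdivrMr// mul1r ler_nat.
Qed.

Lemma upcoming_change_prob_ge (j : 'I_n) :
  ((32 * Num.sqrt n%:R)^-1%:E <= P [set w | upcoming_change j w])%E.
Proof.
rewrite /upcoming_change.
rewrite (state_pair_prob dX (fun x y => (weight x == k.+1) && (weight y <= k)%N)) ?le_time//.
rewrite time_diff// subSnn lee_fin; apply: stationary_crossing_prob_ge.
by have := @resample_time 1 isT; rewrite !div1r.
Qed.

Lemma near_balance_prob_le (p : 'I_n * 'I_n) :
  (P [set w | near_balance p w] <=
  (if (p.2 <= p.1)%N then
    (Num.sqrt n.+1%:R)^-1 * (2 / Num.sqrt (p.1 - p.2).+1%:R) else 0)%:E)%E.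
Proof.
rewrite /near_balance; case: ifP => p21 /=; last first.
  by rewrite (_ : mkset _ = set0) ?measure0//; apply/seteqP; split.
rewrite (state_pair_prob dX (fun x y => (weight x == k.+1) && (weight y == k.+1))) ?le_time//.
have pn : (p.1 - p.2 <= n)%N by have := ltn_ord p.1; lia.
rewrite time_diff// lee_fin stationary_return_prob_le//.
have /andP[-> /le_trans->]// := resample_time pn.
by rewrite ler_pdivrMr// mul1r ler_nat.
Qed.

(** For each later time, the sum over the lags is at most [4 sqrt n / sqrt(n+1) <= 4]. *)
Lemma sum_near_balance_prob_le :
  (\sum_p P [set w | near_balance p w] <= (4 * n%:R)%:E)%E.
Proof.
apply: (@le_trans _ _ (\sum_(p : 'I_n * 'I_n) (if (p.2 <= p.1)%N then
    (Num.sqrt n.+1%:R)^-1 * (2 / Num.sqrt (p.1 - p.2).+1%:R) else 0)%:E)%E).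
  by apply: lee_sum => p _; exact: near_balance_prob_le.
rewrite sumEFin lee_fin.
rewrite -(pair_bigA _ (fun i j : 'I_n => if (j <= i)%N then
   (Num.sqrt n.+1%:R)^-1 * (2 / Num.sqrt (i - j).+1%:R) else 0)) /=.
have -> : 4 * n%:R = \sum_(i < n) (4 : R) by rewrite sumr_const card_ord mulr_natr.
apply: ler_sum => i _.
rewrite -big_mkcond -mulr_sumr.
have s0 : 0 < Num.sqrt n.+1%:R :> R by rewrite sqrtr_gt0.
have g0 m : 0 <= 2 / Num.sqrt m.+1%:R :> R by rewrite divr_ge0 ?sqrtr_ge0.
rewrite ler_pdivrMl// mulrC; apply: (le_trans (sum_lag_le i g0)).
apply: (le_trans (sum_inverse_sqrt_le n)).
by rewrite ler_wpM2l// ler_sqrt// ler_nat.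
Qed.

Lemma sum_upcoming_change_le w :
  ((\sum_j (upcoming_change j w)%:R)%:E <= changes (MAJ n) X w :> \bar R)%E.
Proof.
have cg : cadlag (fun t => MAJ n (state X t w)).
  by apply: cadlag_comp => i; exact: dynamics_cadlag dX i w.
apply: le_trans (grid_changes_le k.*2 cg); rewrite lee_fin -natr_sum ler_nat.
apply: leq_sum => j _; rewrite /upcoming_change !MAJ_weight.
by case: eqP => // ->; rewrite ltnS leqnn; case: leqP.
Qed.

(* With V the number of upcoming changes, C the number of changes and
   K = 256 sqrt n, take expectations in
   V <= |M| + V^2 / (2 K) + (K / 2) 1_{M < C},
   using E V >= sqrt n / 32 and E V^2 <= 8 n. *)
Lemma many_changes_prob_ge (M : R) : 128 * `|M| <= Num.sqrt n%:R ->
  ((128 ^- 2)%:E <= P [set w | (M%:E < changes (MAJ n) X w)%E])%E.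
Proof.
set r := Num.sqrt n%:R => Mr.
have r0 : 0 < r by rewrite sqrtr_gt0.
have rr : n%:R = r ^+ 2 by rewrite sqr_sqrtr.
have mX := dynamics_measurable dX.
set B := [set w | _].
have mB : measurable B.
  by apply: measurable_changes_gt => // i w; exact: dynamics_cadlag dX i w.
pose K : R := 256 * r; have K0 : 0 < K by rewrite mulr_gt0.
have Ki0 : 0 <= K^-1 by rewrite invr_ge0 ltW.
have Kh0 : 0 <= K / 2 by rewrite divr_ge0 ?(ltW K0).
have pointwise w : \sum_j (upcoming_change j w)%:R <=
    `|M| + K^-1 * (\sum_p (near_balance p w)%:R) + K / 2 * \1_B w.
  set V := \sum_j _; set W := \sum_p _.
  have W0 : 0 <= K^-1 * W by apply: mulr_ge0 => //; exact: sumr_ge0.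
  have B0 : 0 <= K / 2 * \1_B w by apply: mulr_ge0 => //; rewrite indicE.
  (* If [V] exceeds [|M|], so does the number of changes, and the indicator of [B] is 1. *)
  have [VM|MV] := leP V `|M|.
    by rewrite -addrA; apply: (le_trans VM); rewrite lerDl addr_ge0.
  have -> : \1_B w = 1 :> R.
    rewrite indicE mem_set// /B /=.
    apply: lt_le_trans (sum_upcoming_change_le w); rewrite lte_fin.
    by apply: le_lt_trans MV; exact: ler_norm.
  have VW : V ^+ 2 <= 2 * W.
    apply: (le_trans (sqr_sum_bool_le (fun j => upcoming_change j w))).
    rewrite ler_wpM2l//; apply: ler_sum => p _; rewrite ler_nat.
    rewrite /upcoming_change /near_balance.
    case: (p.2 <= p.1)%N; case: (weight (state X (time p.2) w) == k.+1);
      case: (weight (state X (time p.1) w) == k.+1) => //=; by rewrite ?andbF ?leq_b1.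
  have := le_half_sqr K0 VW; have := normr_ge0 M; lra.
have mb j : measurable [set w | upcoming_change j w].
  exact: (measurable_state_pair mX (fun x y => (weight x == k.+1) && (weight y <= k)%N)).
have mc p : measurable [set w | near_balance p w].
  exact: (measurable_state_pair mX (fun x y => (p.2 <= p.1)%N &&
    ((weight x == k.+1) && (weight y == k.+1)))).
have := expectation_sum_le P mb mc mB (normr_ge0 M) Ki0 Kh0 pointwise.
have lower : ((r / 32)%:E <= \sum_j P [set w | upcoming_change j w])%E.
  apply: (@le_trans _ _ (\sum_(j < n) (32 * r)^-1%:E)%E).
    rewrite sumEFin lee_fin sumr_const card_ord -[leRHS]mulr_natl rr.
    by rewrite le_eqVlt; apply/orP; left; apply/eqP; field; rewrite gt_eqF.
  by apply: lee_sum => j _; exact: upcoming_change_prob_ge.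
have upper : (K^-1%:E * \sum_p P [set w | near_balance p w] <=
    K^-1%:E * (4 * n%:R)%:E)%E.
  by apply: lee_wpmul2l; [rewrite lee_fin|exact: sum_near_balance_prob_le].
have PB : P B \is a fin_num by rewrite fin_num_measure.
rewrite -(fineK PB) lee_fin; set p := fine (P B).
move=> /(le_trans lower) h.
have {h} : ((r / 32)%:E <= (`|M| + K^-1 * (4 * n%:R) + K / 2 * p)%:E)%E.
  apply: (le_trans h); rewrite 2!EFinD [(K / 2 * p)%:E]EFinM [(K^-1 * _)%:E]EFinM.
  by apply: leeD => //; apply: leeD.
rewrite lee_fin rr.
(* Out of [r/32], the pairs use [r/64] and [|M|] at most [r/128]; the remaining [r/128] is at most
   [(K/2) p = 128 r p]. *)
have -> : K^-1 * (4 * r ^+ 2) = r / 64 by rewrite /K; field; rewrite gt_eqF.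
rewrite /K => h; have {h} : r * (128^-1 * 128^-1) <= r * p by lra.
by rewrite ler_pM2l// expr2 invfM.
Qed.

End majority_dynamics.

(* The odd integers are enumerated as k.*2.+1 for k : nat. *)
Theorem proposition1p15 (R : realType) :
  noise_stable (fun k : nat => MAJ k.*2.+1) (fun _ : nat => 2^-1 : R) /\
  (forall (d : nat -> measure_display)
          (T : forall k : nat, measurableType (d k))
          (P : forall k : nat, probability (T k) R)
          (X : forall k : nat, 'I_k.*2.+1 -> R -> T k -> bool),
     (forall k : nat, dynamics (P k) (2^-1) (X k)) ->
     ~ tame (fun k : nat => MAJ k.*2.+1) P X).
Proof.
split; first exact: MAJ_noise_stable.
move=> d T P X dX tX; have c0 : 0 < 128 ^- 2 :> R by rewrite invr_gt0 exprn_gt0.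
have [|M hM] := tX (128 ^- 2 / 2); first by rewrite divr_gt0.
(* Chosen so that [n = 2k+1] is at least [(128 |M|)^2]; the probability is then at least [128 ^- 2],
   twice what tightness allows. *)
pose k := Num.truncn ((128 * `|M|) ^+ 2).
have kM : 128 * `|M| <= Num.sqrt k.*2.+1%:R.
  rewrite -[leLHS]ger0_norm ?mulr_ge0// -sqrtr_sqr ler_sqrt//.
  by apply: (le_trans (ltW (truncnS_gt _))); rewrite ler_nat -/k; lia.
have := le_trans (many_changes_prob_ge (dX k) kM) (hM k).
rewrite lee_fin; move: (128 ^- 2) c0 => c c0; lra.
Qed.
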